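(* Let $X$ be a finite-dimensional normed space and $\Delta>1$. Suppose there is a map $f:X\to H$ into a Hilbert space $H$ such that, for an absolute constant $K>0$ and all $x_1,x_2\in X$: $\|f(x_1)-f(x_2)\|_H\le K\|x_1-x_2\|_X^{1/2}$, and if $\|x_1-x_2\|_X\ge\Delta$ then $\|f(x_1)-f(x_2)\|_H\ge1$. Then for every $\varepsilon\in(0,1/3)$, $X$ linearly embeds into $\ell_{1-\varepsilon}$ with distortion $O(\Delta/\varepsilon)$.
   Context: For $0<p<1$, $\ell_p$ is the space of real sequences with $\|y\|_p=(\sum_i|y_i|^p)^{1/p}<\infty$. A linear map $T:X\to Y$ has distortion $D'$ if there is $t>0$ with $\|Tx\|\le t\|x\|\le D'\|Tx\|$ for all $x\in X$; $X$ linearly embeds into $Y$ with distortion $D'$ if such a $T$ exists. *)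

(* Defs.v *)
From HB Require Import structures.
From mathcomp Require Import all_boot all_order all_algebra.
From mathcomp Require Import all_classical all_reals all_analysis.
Set Implicit Arguments.
Unset Strict Implicit.
Unset Printing Implicit Defensive.
Import Order.TTheory GRing.Theory Num.Theory.
Import numFieldNormedType.Exports.
Local Open Scope classical_set_scope.
Local Open Scope ring_scope.

#[short(type="finDimNormedModType")]
HB.structure Definition FinDimNormedModule (R : numFieldType) :=
  {X of NormedModule R X & Vector R X}.

Definition is_hilbert (R : realType) (H : completeNormedModType R) : Prop :=
  exists dot : {dot H for idfun}, forall u : H, `|u| = Num.sqrt (dot u u).

(* For 0 < p the value is +oo exactly when y is not p-summable. *)
Definition ellnorm (R : realType) (p : R) (y : R^nat) : \bar R :=
  'N[counting]_p%:E[EFin \o y]%E.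

Definition ell (R : realType) (p : R) : set (R^nat) :=
  [set y | (ellnorm p y < +oo)%E].

Definition linearly_embeds_ell (R : realType) (X : normedModType R) (p D : R)
    : Prop :=
  exists T : {linear X -> R^nat},
    (forall x : X, ell p (T x)) /\
    exists2 t : R, 0 < t &
      forall x : X, (ellnorm p (T x) <= (t * `|x|)%:E /\
                     (t * `|x|)%:E <= D%:E * ellnorm p (T x))%E.

(* Main.v *)
(* The map f is restricted to a box in a fine lattice of X.  The Gaussian kernel
   exp(-|f(a) - f(b)|^2) is positive definite there, so its Fourier transform on
   the finite torus, averaged along diagonals, gives nonnegative weights on
   linear functionals; as the box grows, boundary effects vanish, and the sum of
   w_t (1 - cos <theta_t, x>) is at most K^2 |x|, and at least about 1/2 as soon
   as |x| >= Delta.  Comparing |y|^p with cosines at dyadic scales,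
   |y|^p <= 1 + C sum_j 2^(jp) (1 - cos (y / 2^j)), turns the first bound into
   p-th moments of order (|x|^p) / eps, and 1 - cos y <= 2 |y|^p turns the second
   into a lower bound on these moments.  Rounding to the lattice extends both
   bounds from lattice points to X, since x |-> sum_t w_t |<theta_t, x>|^p is
   subadditive and p-homogeneous. *)
From HB Require Import structures.
Require Import Defs.
From mathcomp Require Import all_boot all_order all_algebra.
From mathcomp Require Import all_classical all_reals all_analysis.
From mathcomp Require Import zify ring lra.
Set Implicit Arguments.
Unset Strict Implicit.
Unset Printing Implicit Defensive.
Import Order.TTheory GRing.Theory Num.Theory.
Import numFieldNormedType.Exports.
Local Open Scope ring_scope.

(** * Positive semidefinite kernels on a finite set *)

Definition psd (R : realType) (T : finType) (G : T -> T -> R) : Prop :=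
  (forall a b, G a b = G b a) /\
  forall c : T -> R, 0 <= \sum_a \sum_b c a * c b * G a b.

Lemma sum_delta (R : realType) (T : finType) (z : T) (h : T -> R) :
  \sum_a (a == z)%:R * h a = h z.
Proof.
rewrite (bigD1 z) //= eqxx mul1r big1 ?addr0 // => a /negbTE ->.
by rewrite mul0r.
Qed.

(** This is the quadratic form at [c] plus [t] times the indicator of [z]. It is quadratic in [t],
    and well-chosen values of [t] give the next lemmas. *)
Lemma psd_form_shift (R : realType) (T : finType) (G : T -> T -> R)
    (c : T -> R) (z : T) (t : R) : psd G ->
  0 <= \sum_a \sum_b c a * c b * G a b + 2 * t * (\sum_a c a * G a z)
       + t ^+ 2 * G z z.
Proof.
move=> [symG posG]; have := posG (fun a => c a + t * (a == z)%:R).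
congr (0 <= _).
under eq_bigr => a _.
  under eq_bigr => b _.
    rewrite (_ : _ * _ = c a * c b * G a b + t * ((b == z)%:R * (c a * G a b))
      + t * ((a == z)%:R * (c b * G a b))
      + t ^+ 2 * ((a == z)%:R * ((b == z)%:R * G a b))); last by ring.
    over.
  rewrite !big_split /= -!mulr_sumr !sum_delta.
  over.
rewrite !big_split /= -!mulr_sumr !sum_delta.
have -> : \sum_b c b * G z b = \sum_b c b * G b z.
  by apply: eq_bigr => b _; rewrite symG.
by ring.
Qed.

Lemma psd_diag_ge0 (R : realType) (T : finType) (G : T -> T -> R) (z : T) :
  psd G -> 0 <= G z z.
Proof.
move=> /(@psd_form_shift _ _ _ (fun=> 0) z 1).
rewrite [X in X + _ + _]big1 ?[X in _ * X]big1 ?mulr0 ?add0r ?expr1n ?mul1r//.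
  by move=> i _; rewrite mul0r.
by move=> i _; rewrite big1 // => j _; rewrite !mul0r.
Qed.

Lemma psd_diag_eq0 (R : realType) (T : finType) (G : T -> T -> R) (z : T) :
  psd G -> G z z = 0 -> forall x, G x z = 0.
Proof.
move=> pG Gz x; apply/eqP; apply/negP => /negP nz.
(* Since [G z z = 0], the form at the indicator of [x] is affine in [t] with slope [2 * G x z]; this
   [t] brings it down to -1. *)
have := @psd_form_shift _ _ _ (fun a => (a == x)%:R) z
  (- (G x x + 1) / (2 * G x z)) pG.
under eq_bigr => a _.
  under eq_bigr => b _ do rewrite -mulrA.
  rewrite -mulr_sumr sum_delta.
  over.
rewrite !sum_delta Gz mulr0 addr0.
have -> : G x x + 2 * (- (G x x + 1) / (2 * G x z)) * G x z = -1 by field.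
by rewrite lerNr oppr0 ler10.
Qed.

(** Elimination by Schur complements: a pivot [z] with [G z z != 0] splits off a rank-one kernel,
    and the remainder is positive semidefinite with fewer nonzero diagonal entries. *)
Lemma psd_factor (R : realType) (T : finType) (G : T -> T -> R) : psd G ->
  exists s : seq (T -> R), forall a b, G a b = \sum_(phi <- s) phi a * phi b.
Proof.
have [n] := ubnP #|[set a | G a a != 0]|.
elim: n G => // n IHn G; rewrite ltnS => leG pG.
have [z Gz|G0] := pickP (fun a => G a a != 0); last first.
  exists [::] => a b; rewrite big_nil (psd_diag_eq0 pG) //.
  by apply/eqP; have /negbFE := G0 b.
have Gz0 : 0 < G z z by rewrite lt_neqAle eq_sym Gz psd_diag_ge0.
have symG := pG.1.
pose G' a b := G a b - G a z * G b z / G z z.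
have pG' : psd G'.
  split=> [a b|c]; first by rewrite /G' symG [G b z * _]mulrC.
  (* This [t] minimises the shifted form, and the minimum is the form of the Schur complement [G']
     at [c]. *)
  have := psd_form_shift c z (- (\sum_a c a * G a z) / G z z) pG.
  congr (0 <= _); set S := \sum_a c a * G a z.
  rewrite /G'.
  transitivity (\sum_a \sum_b c a * c b * G a b - S * S / G z z); last first.
    rewrite /S big_distrlr /= mulr_suml -sumrB.
    apply: eq_bigr => a _; rewrite mulr_suml -sumrB.
    by apply: eq_bigr => b _; field.
  by field.
have [|s Hs] := IHn G' _ pG'.
  apply: leq_trans leG; apply: proper_card; apply/properP; split.
    apply/fintype.subsetP => a; rewrite !inE; apply: contraNN => /eqP Ga.
    by rewrite /G' symG !(psd_diag_eq0 pG Ga) !mul0r subr0.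
  by exists z; rewrite !inE // /G' mulfK // subrr eqxx.
exists ((fun a => G a z / Num.sqrt (G z z)) :: s) => a b.
rewrite big_cons -Hs /G' mulrACA -invfM -expr2 sqr_sqrtr ?ltW //.
by ring.
Qed.

Lemma psd_rank1 (R : realType) (T : finType) (phi : T -> R) :
  psd (fun a b => phi a * phi b).
Proof.
split=> [a b|c]; first exact: mulrC.
rewrite (_ : \sum_a _ = (\sum_a c a * phi a) ^+ 2) ?sqr_ge0 //.
rewrite expr2 big_distrlr /=; apply: eq_bigr => a _.
by apply: eq_bigr => b _; ring.
Qed.

Lemma psdD (R : realType) (T : finType) (G G' : T -> T -> R) :
  psd G -> psd G' -> psd (fun a b => G a b + G' a b).
Proof.
move=> [sG pG] [sG' pG']; split=> [a b|c]; first by rewrite sG sG'.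
rewrite (eq_bigr (fun a => \sum_b c a * c b * G a b
                         + \sum_b c a * c b * G' a b)) => [|a _]; last first.
  by rewrite -big_split; apply: eq_bigr => b _; rewrite mulrDr.
by rewrite big_split addr_ge0 ?pG ?pG'.
Qed.

Lemma psdZ (R : realType) (T : finType) (k : R) (G : T -> T -> R) :
  0 <= k -> psd G -> psd (fun a b => k * G a b).
Proof.
move=> k0 [sG pG]; split=> [a b|c]; first by rewrite sG.
rewrite (_ : \sum_a _ = k * \sum_a \sum_b c a * c b * G a b) ?mulr_ge0 //.
rewrite mulr_sumr; apply: eq_bigr => a _; rewrite mulr_sumr.
by apply: eq_bigr => b _; ring.
Qed.

(** Schur's product theorem: with [G] written as a sum of rank-one kernels, each summand of the
    product form is the form of [G'] at [c] multiplied pointwise by [phi]. *)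
Lemma psdM (R : realType) (T : finType) (G G' : T -> T -> R) :
  psd G -> psd G' -> psd (fun a b => G a b * G' a b).
Proof.
move=> pG [sG' pG']; split=> [a b|c]; first by rewrite sG' (proj1 pG).
have [s Gs] := psd_factor pG.
rewrite (_ : \sum_a _ =
    \sum_(phi <- s) \sum_a \sum_b (c a * phi a) * (c b * phi b) * G' a b).
  by apply: sumr_ge0 => phi _; apply: pG'.
rewrite [RHS]exchange_big; apply: eq_bigr => a _ /=.
rewrite [RHS]exchange_big.
apply: eq_bigr => b _ /=; rewrite Gs mulr_suml mulr_sumr.
by apply: eq_bigr => phi _; ring.
Qed.

Lemma psdX (R : realType) (T : finType) (G : T -> T -> R) (n : nat) :
  psd G -> psd (fun a b => G a b ^+ n).
Proof.
move=> pG; elim: n => [|n IHn].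
  rewrite (_ : (fun _ _ => _) = (fun=> fun=> 1 * 1)); first exact: psd_rank1.
  by apply/funext => a; apply/funext => b; rewrite mulr1.
rewrite (_ : (fun _ _ => _) = (fun a b => G a b * G a b ^+ n)).
  exact: psdM.
by apply/funext => a; apply/funext => b; rewrite exprS.
Qed.

(** The partial sums of the exponential series are nonnegative combinations of entrywise powers, and
    nonnegativity of a form passes to the limit. *)
Lemma psd_expR (R : realType) (T : finType) (G : T -> T -> R) :
  psd G -> psd (fun a b => expR (G a b)).
Proof.
move=> pG; split=> [a b|c]; first by rewrite (proj1 pG).
have cvgQ : ((\sum_a \sum_b c a * c b * series (exp_coeff (G a b)) m)
    @[m --> \oo] --> \sum_a \sum_b c a * c b * expR (G a b))%classic.
  apply: cvg_big => [|a _]; first exact: add_continuous.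
  apply: cvg_big => [|b _]; first exact: add_continuous.
  apply: cvgMl_tmp.
  exact: is_cvg_series_exp_coeff.
apply: (cvgr_to_ge cvgQ); apply: nearW => m.
suff [_] : psd (fun a b => series (exp_coeff (G a b)) m) by apply.
elim: m => [|m IHm].
  split=> [a b|c']; first by rewrite (proj1 pG).
  rewrite big1 // => a _; rewrite big1 // => b _.
  by rewrite /series /= big_geq // mulr0.
rewrite (_ : (fun _ _ => _) = (fun a b =>
    series (exp_coeff (G a b)) m + m`!%:R^-1 * G a b ^+ m)).
  by apply: psdD => //; apply: psdZ; rewrite ?invr_ge0 ?ler0n //; apply: psdX.
apply/funext => a; apply/funext => b.
by rewrite /series /= big_nat_recr //= /exp_coeff [_^-1 * _]mulrC.
Qed.

(** * Characters of the discrete torus and their orthogonality *)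

(* 'I_N.+2 is the ring of residues modulo N.+2, and its n-th power is its own
   dual group through the pairing zpair. *)
Notation torus n N := {ffun 'I_n -> 'I_N.+2}.

Definition zpair (n N : nat) (a t : torus n N) : 'I_N.+2 :=
  \sum_j a j * t j.

Definition zangle (R : realType) (N : nat) : R := pi *+ 2 / N.+2%:R.

(** [zcos] and [zsin] are the real and imaginary parts of the standard character of the integers
    modulo [N.+2]. *)
Definition zcos (R : realType) (N : nat) (z : 'I_N.+2) : R :=
  cos (zangle R N * (z : nat)%:R).

Definition zsin (R : realType) (N : nat) (z : 'I_N.+2) : R :=
  sin (zangle R N * (z : nat)%:R).

Definition residues (n N : nat) (k : 'I_n -> int) : torus n N :=
  [ffun j => (k j)%:~R].

Lemma zpairDl (n N : nat) (a b t : torus n N) :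
  zpair (a + b) t = zpair a t + zpair b t.
Proof.
by rewrite -big_split; apply: eq_bigr => j _; rewrite ffunE mulrDl.
Qed.

Lemma zpairDr (n N : nat) (a t u : torus n N) :
  zpair a (t + u) = zpair a t + zpair a u.
Proof.
by rewrite -big_split; apply: eq_bigr => j _; rewrite ffunE mulrDr.
Qed.

Lemma zpairNl (n N : nat) (a t : torus n N) :
  zpair (- a) t = - zpair a t.
Proof. by rewrite -sumrN; apply: eq_bigr => j _; rewrite ffunE mulNr. Qed.

Lemma zpairNr (n N : nat) (a t : torus n N) :
  zpair a (- t) = - zpair a t.
Proof. by rewrite -sumrN; apply: eq_bigr => j _; rewrite ffunE mulrN. Qed.

Lemma periodic_int (R : zmodType) (V : zmodType) (f : R -> V) (T : R) :
  periodic f T -> forall (q : int) x, f (x + T *~ q) = f x.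
Proof.
move=> pf [q|q] x; first exact: periodicn.
by rewrite -[LHS](periodicn pf q.+1) NegzE mulrNz subrK.
Qed.

(** Reducing an integer modulo [N.+2] changes the angle by whole turns, so cosines and sines of
    residues can be computed on any integer representative. *)
Lemma zangle_period (R : realType) (N : nat) (m : int) :
  zangle R N * m%:~R =
  zangle R N * ((m%:~R : 'I_N.+2) : nat)%:R + (pi *+ 2) *~ (m %/ N.+2)%Z.
Proof.
set q := (m %/ _)%Z; set r := `|(m %% N.+2)%Z|%N.
have rE : r%:Z = (m %% N.+2)%Z by rewrite gez0_abs ?modz_ge0.
have rN : (r < N.+2)%N by rewrite -ltz_nat rE ltz_pmod.
have mE : m = q * N.+2%:Z + r%:Z by rewrite rE -divz_eq.
have -> : (m%:~R : 'I_N.+2) = r%:R.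
  rewrite mE intrD intrM -!pmulrn (_ : N.+2%:R = 0) ?mulr0 ?add0r //.
  by apply/val_inj; rewrite Zp_nat /= modnn.
rewrite Zp_nat /= modn_small // {1}mE intrD intrM addrC mulrDr -!pmulrn.
congr (_ + _); rewrite /zangle mulrCA mulrVK ?unitfE ?pnatr_eq0 //.
by rewrite mulrzl.
Qed.

Lemma zcos_intr (R : realType) (N : nat) (m : int) :
  zcos R (m%:~R : 'I_N.+2) = cos (zangle R N * m%:~R).
Proof. by rewrite zangle_period (periodic_int (@cosD2pi R)). Qed.

Lemma zsin_intr (R : realType) (N : nat) (m : int) :
  zsin R (m%:~R : 'I_N.+2) = sin (zangle R N * m%:~R).
Proof. by rewrite zangle_period (periodic_int (@sinD2pi R)). Qed.

Lemma residue_intr (N : nat) (z : 'I_N.+2) : ((z : nat)%:Z)%:~R = z.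
Proof. by rewrite -pmulrn natr_Zp. Qed.

Lemma zcos0 (R : realType) (N : nat) : zcos R (0 : 'I_N.+2) = 1.
Proof. by rewrite /zcos mulr0 cos0. Qed.

Lemma zcosN (R : realType) (N : nat) (z : 'I_N.+2) : zcos R (- z) = zcos R z.
Proof.
by rewrite -(residue_intr z) -mulrNz !zcos_intr mulrNz mulrN cosN.
Qed.

Lemma zsinN (R : realType) (N : nat) (z : 'I_N.+2) : zsin R (- z) = - zsin R z.
Proof.
by rewrite -(residue_intr z) -mulrNz !zsin_intr mulrNz mulrN sinN.
Qed.

Lemma zcosD (R : realType) (N : nat) (x y : 'I_N.+2) :
  zcos R (x + y) = zcos R x * zcos R y - zsin R x * zsin R y.
Proof.
rewrite -(residue_intr x) -(residue_intr y) -intrD !zcos_intr !zsin_intr.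
by rewrite intrD mulrDr cosD.
Qed.

Lemma one_sub_cos (R : realType) (x : R) : 1 - cos x = 2 * sin (x / 2) ^+ 2.
Proof.
rewrite {1}(_ : x = (x / 2) *+ 2); last by rewrite -mulr_natr; field.
by rewrite cos_mulr2n; have := cos2Dsin2 (x / 2); lra.
Qed.

Lemma zcos_lt1 (R : realType) (N : nat) (z : 'I_N.+2) : z != 0 -> zcos R z < 1.
Proof.
move=> z0; rewrite -subr_gt0 one_sub_cos mulr_gt0 // exprn_even_gt0 //=.
apply: lt0r_neq0; apply: sin_gt0_pi.
have zp : (0 < z)%N by rewrite lt0n; apply: contra_neq z0 => z0; apply/val_inj.
have p0 := pi_gt0 R; have N0 : 0 < N.+2%:R :> R by rewrite ltr0n.
have -> : zangle R N * z%:R / 2 = pi * (z%:R / N.+2%:R).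
  by rewrite /zangle -mulr_natr; field; rewrite lt0r_neq0.
rewrite mulr_gt0 ?divr_gt0 ?ltr0n //= gtr_pMr //.
by rewrite ltr_pdivrMr // mul1r ltr_nat.
Qed.

Lemma sum_zsin (R : realType) (n N : nat) (k : torus n N) :
  \sum_t zsin R (zpair k t) = 0.
Proof.
set S := \sum_t _; suff : S = - S by move=> ?; lra.
rewrite {1}/S (reindex_inj (@oppr_inj (torus n N))) -sumrN.
by apply: eq_bigr => t _; rewrite zpairNr zsinN.
Qed.

(** Orthogonality of characters: if [k j != 0], translating the sum by the [j]-th unit vector
    multiplies it by [zcos R (k j) < 1], as the sine sum vanishes by oddness; hence it is zero. *)
Lemma sum_zcos (R : realType) (n N : nat) (k : torus n N) :
  \sum_t zcos R (zpair k t) = #|{: torus n N}|%:R * (k == 0)%:R.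
Proof.
have [->|k0] := eqVneq k 0.
  rewrite mulr1 -sum1_card natr_sum; apply: eq_bigr => t _.
  rewrite /zpair big1 ?zcos0 // => j _.
  by rewrite ffunE mul0r.
rewrite mulr0; have [j kj] : exists j, k j != 0.
  apply/existsP; apply: contraR k0 => /existsPn k0; apply/eqP/ffunP => j.
  by rewrite ffunE; apply/eqP; rewrite -[_ == _]negbK k0.
pose d : torus n N := [ffun i => (i == j)%:R].
have kd : zpair k d = k j.
  rewrite /zpair (bigD1 j) //= ffunE eqxx mulr1 big1 ?addr0 // => i /negbTE ij.
  by rewrite ffunE ij mulr0.
have : \sum_t zcos R (zpair k t) =
    (\sum_t zcos R (zpair k t)) * zcos R (k j)
    - (\sum_t zsin R (zpair k t)) * zsin R (k j).
  rewrite {1}(reindex_inj (@addIr (torus n N) d)) !mulr_suml -sumrB.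
  by apply: eq_bigr => t _; rewrite zpairDr zcosD kd.
rewrite sum_zsin mul0r subr0 => /eqP; rewrite -subr_eq0 -[X in X - _]mulr1.
rewrite -mulrBr mulf_eq0 => /orP[/eqP //|].
by rewrite subr_eq0 eq_sym lt_eqF // zcos_lt1.
Qed.

(** * Spectral weights of a kernel on the torus *)

(** This is the Fourier transform of the function taking [k] to the average of [G a b] over the
    pairs with [a - b = k]. *)
Definition spectral_weight (R : realType) (n N : nat)
    (G : torus n N -> torus n N -> R)
    (t : torus n N) : R :=
  (\sum_a \sum_b G a b * zcos R (zpair (a - b) t))
  / #|{: torus n N}|%:R ^+ 2.

Lemma card_torus_gt0 (R : realType) (n N : nat) :
  0 < #|{: torus n N}|%:R :> R.
Proof. by rewrite ltr0n; apply/card_gt0P; exists 0. Qed.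

(** The addition formula for the cosine splits the numerator into the form of [G] at the real part
    of the character plus the form at its imaginary part. *)
Lemma spectral_weight_ge0 (R : realType) (n N : nat)
    (G : torus n N -> torus n N -> R) t :
  psd G -> 0 <= spectral_weight G t.
Proof.
move=> [_ pG]; rewrite /spectral_weight divr_ge0 ?sqr_ge0 //.
have -> : \sum_a \sum_b G a b * zcos R (zpair (a - b) t) =
    \sum_a \sum_b zcos R (zpair a t) * zcos R (zpair b t) * G a b
  + \sum_a \sum_b zsin R (zpair a t) * zsin R (zpair b t) * G a b.
  rewrite -big_split; apply: eq_bigr => a _ /=.
  rewrite -big_split; apply: eq_bigr => b _ /=.
  by rewrite zpairDl zpairNl zcosD zcosN zsinN; ring.
by rewrite addr_ge0 ?pG.
Qed.

(** Fourier inversion. Cosines alone see the diagonals [k] and [- k] together; symmetry of [G] makes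
    their averages equal. *)
Lemma spectral_weight_cos (R : realType) (n N : nat)
    (G : torus n N -> torus n N -> R) k :
  (forall a b, G a b = G b a) ->
  \sum_t spectral_weight G t * zcos R (zpair k t) =
  (\sum_(b : torus n N) G (b + k) b) / #|{: torus n N}|%:R.
Proof.
move=> symG; set T := #|_|%:R; have T0 : T != 0 := lt0r_neq0 (card_torus_gt0 R n N).
have inner d : \sum_t zcos R (zpair d t) * zcos R (zpair k t) =
    T / 2 * (d == - k)%:R + T / 2 * (d == k)%:R.
  rewrite -(subr_eq0 d k) -addr_eq0 -2!mulrA ![2^-1 * _]mulrC !mulrA -!sum_zcos.
  rewrite -mulrDl -big_split mulr_suml; apply: eq_bigr => t _ /=.
  by rewrite !zpairDl zpairNl !zcosD zcosN zsinN; field.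
have half (d : torus n N) :
    \sum_a \sum_b G a b * (a - b == d)%:R = \sum_(b : torus n N) G (b + d) b.
  rewrite exchange_big; apply: eq_bigr => b _ /=.
  rewrite (bigD1 (b + d)) //= addrAC subrr add0r eqxx mulr1 big1 ?addr0 //.
  by move=> a; rewrite subr_eq addrC => /negbTE ->; rewrite mulr0.
transitivity ((\sum_a \sum_b G a b *
    (T / 2 * (a - b == - k)%:R + T / 2 * (a - b == k)%:R)) / T ^+ 2).
  rewrite /spectral_weight -/T.
  under eq_bigr => t _ do rewrite mulrAC mulr_suml.
  rewrite -mulr_suml exchange_big; congr (_ / _); apply: eq_bigr => a _ /=.
  under eq_bigr => t _ do rewrite mulr_suml.
  rewrite exchange_big; apply: eq_bigr => b _ /=.
  by rewrite -inner mulr_sumr; apply: eq_bigr => t _; rewrite mulrA.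
transitivity ((T / 2 * \sum_(b : torus n N) G (b - k) b
    + T / 2 * \sum_(b : torus n N) G (b + k) b) / T ^+ 2).
  congr (_ / _); rewrite -!half !mulr_sumr -big_split; apply: eq_bigr => a _ /=.
  rewrite !mulr_sumr -big_split; apply: eq_bigr => b _ /=.
  by ring.
have -> : \sum_(b : torus n N) G (b - k) b = \sum_(b : torus n N) G (b + k) b.
  rewrite (reindex_inj (@addIr (torus n N) k)).
  by apply: eq_bigr => b _; rewrite addrK symG.
by field.
Qed.

(** * Boundary effects of translations *)

Lemma torus_marginal (R : realType) (n N : nat) (j : 'I_n) (F : 'I_N.+2 -> R) :
  N.+2%:R * (\sum_(b : torus n N) F (b j)) =
  #|{: torus n N}|%:R * \sum_z F z.
Proof.
pose d (z : 'I_N.+2) : torus n N := [ffun i => z *+ (i == j)].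
transitivity (\sum_(z : 'I_N.+2) \sum_(b : torus n N) F (b j + z)).
  transitivity (\sum_(z : 'I_N.+2) \sum_(b : torus n N) F (b j)).
    by rewrite sumr_const card_ord mulr_natl.
  apply: eq_bigr => z _.
  rewrite (reindex_inj (@addIr (torus n N) (d z))).
  by apply: eq_bigr => b _; rewrite !ffunE eqxx.
rewrite exchange_big -[in RHS]sumr_const mulr_suml /=.
apply: eq_bigr => b _; rewrite mul1r.
by rewrite [RHS](reindex_inj (@addrI 'I_N.+2 (b j))).
Qed.

(** Translation by [k] does not wrap around in coordinate [j], so addition modulo [N.+2] agrees
    there with addition of integers. *)
Definition stays (n N : nat) (k : 'I_n -> int) (b : torus n N)
    (j : 'I_n) : bool :=
  (0 <= (b j : nat)%:Z + k j) && ((b j : nat)%:Z + k j < N.+2%:Z).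

Lemma residues_stays (n N : nat) (k : 'I_n -> int)
    (b : torus n N) (j : 'I_n) :
  stays k b j ->
  (((b + residues N k)%R j : nat)%:Z : int) = (b j : nat)%:Z + k j.
Proof.
move=> /andP[s0 sN]; rewrite !ffunE -[X in X + _]residue_intr -intrD.
move: s0 sN; case: (_ + k j) => // m _ mN.
by rewrite -pmulrn Zp_nat /= modn_small.
Qed.

Lemma card_sub_iota (N a m : nat) (P : pred 'I_N) :
  (forall z, P z -> (a <= z < a + m)%N) -> (#|P| <= m)%N.
Proof.
move=> Pam; rewrite cardE -(size_map val) -[leqRHS](size_iota a m).
apply: uniq_leq_size; first by rewrite map_inj_uniq ?enum_uniq //; apply: val_inj.
by move=> _ /mapP[z zP ->]; rewrite mem_iota; apply: Pam; rewrite mem_enum in zP.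
Qed.

(** A union bound over the coordinates: coordinate [j] is uniform on the residues, and at most
    [|k j|] of these wrap around. *)
Lemma wrap_fraction (R : realType) (n N : nat) (k : 'I_n -> int) :
  (\sum_(b : torus n N) (~~ [forall j, stays k b j])%:R : R)
  <= #|{: torus n N}|%:R * ((\sum_j `|k j|%N)%:R / N.+2%:R).
Proof.
pose bad j (z : 'I_N.+2) :=
  ~~ ((0 <= (z : nat)%:Z + k j) && ((z : nat)%:Z + k j < N.+2%:Z)).
have N0 : 0 < N.+2%:R :> R by rewrite ltr0n.
apply: (@le_trans _ _ (\sum_(b : torus n N) \sum_j (bad j (b j))%:R)).
  apply: ler_sum => b _; case: (boolP [forall j, _]) => [_|/forallPn[j bj]].
    by rewrite sumr_ge0 // => j _; case: bad.
  rewrite (bigD1 j) //= (_ : bad j (b j) = true) ?lerDl; last exact: bj.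
  by rewrite sumr_ge0 // => i _; case: bad.
rewrite exchange_big /= natr_sum mulr_suml mulr_sumr; apply: ler_sum => j _.
rewrite mulrA ler_pdivlMr // mulrC (torus_marginal j (fun z => (bad j z)%:R)).
rewrite ler_wpM2l // -natr_sum ler_nat -big_mkcond /= sum1_card.
(* A nonnegative shift [m] can only wrap the last [m] residues; a shift by [-(m + 1)] wraps only the
   first [m + 1]. *)
case kj : (k j) => [m|m].
  apply: (@card_sub_iota _ (N.+2 - m)) => z; have := ltn_ord z.
  by lia.
apply: (@card_sub_iota _ 0) => z; have := ltn_ord z.
by lia.
Qed.

(** * Frequencies as real angles *)

(** The representative of least absolute value keeps the angles within [[-pi, pi]], where the size
    of an angle can be read off its cosine. *)
Definition central_rep (N : nat) (z : 'I_N.+2) : int :=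
  if (2 * z <= N.+2)%N then (z : nat)%:Z else (z : nat)%:Z - N.+2%:Z.

Definition torus_angle (R : realType) (n N : nat) (t : torus n N) (j : 'I_n) : R :=
  zangle R N * (central_rep (t j))%:~R.

Definition int_dot (R : realType) (n : nat) (k : 'I_n -> int) (th : 'I_n -> R) : R :=
  \sum_j (k j)%:~R * th j.

Lemma central_repE (N : nat) (z : 'I_N.+2) : (central_rep z)%:~R = z.
Proof.
rewrite /central_rep; case: ifP => _; first exact: residue_intr.
rewrite intrB residue_intr (_ : N.+2%:Z%:~R = 0) ?subr0 //.
by apply/val_inj; rewrite -pmulrn Zp_nat /= modnn.
Qed.

Lemma torus_angle_le_pi (R : realType) (n N : nat) (t : torus n N) (j : 'I_n) :
  `|torus_angle R t j| <= pi.
Proof.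
have N0 : 0 < N.+2%:R :> R by rewrite ltr0n.
have p0 := pi_gt0 R.
have a0 : 0 < zangle R N by rewrite /zangle divr_gt0 // mulrn_wgt0.
rewrite /torus_angle normrM gtr0_norm // -intr_norm.
have : `|central_rep (t j)| * 2 <= N.+2%:Z.
  by rewrite /central_rep; have := ltn_ord (t j); case: ifP; lia.
rewrite -(ler_int R) intrM /zangle -pmulrn mulrAC ler_pdivrMr // => h.
rewrite (_ : _ * _ = pi * (`|central_rep (t j)|%:~R * 2)); last by ring.
by rewrite ler_wpM2l // ltW.
Qed.

Lemma cos_int_dot (R : realType) (n N : nat) (k : 'I_n -> int) (t : torus n N) :
  cos (int_dot k (torus_angle R t)) = zcos R (zpair (residues N k) t).
Proof.
rewrite (_ : int_dot _ _ =
    zangle R N * (\sum_j k j * central_rep (t j))%:~R); last first.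
  rewrite rmorph_sum mulr_sumr; apply: eq_bigr => j _.
  by rewrite rmorphM mulrCA.
rewrite -zcos_intr; congr zcos; rewrite rmorph_sum.
by apply: eq_bigr => j _; rewrite ffunE rmorphM /= central_repE.
Qed.

(** * Gaussian kernels in a Hilbert space and the spectral measure *)

Lemma dot_self (R : realType) (H : completeNormedModType R)
    (dot : {dot H for idfun}) :
  (forall u : H, `|u| = Num.sqrt (dot u u)) ->
  forall u, dot u u = `|u| ^+ 2.
Proof.
move=> normE u; rewrite normE sqr_sqrtr //.
have [->|u0] := eqVneq u 0; first by rewrite linear0l.
by apply/ltW/neq0_dnorm_gt0.
Qed.

Lemma psd_gram (R : realType) (H : completeNormedModType R)
    (dot : {dot H for idfun}) (T : finType) (g : T -> H) :
  (forall u : H, `|u| = Num.sqrt (dot u u)) ->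
  psd (fun a b => dot (g a) (g b)).
Proof.
move=> normE; split=> [a b|c].
  by rewrite hermC expr0 mul1r.
have -> : \sum_a \sum_b c a * c b * dot (g a) (g b) =
    dot (\sum_a c a *: g a) (\sum_b c b *: g b).
  rewrite linear_sumlz; apply: eq_bigr => a _.
  rewrite linear_sumr; apply: eq_bigr => b _.
  by rewrite [RHS]linearZr_LR /= [in RHS]linearZl_LR mulrCA mulrA.
by rewrite (dot_self normE) sqr_ge0.
Qed.

(** Expanding the squared norm factors the kernel into a rank-one kernel and the exponential of
    twice a Gram kernel. *)
Lemma psd_gaussian (R : realType) (H : completeNormedModType R) (T : finType)
    (g : T -> H) : is_hilbert H ->
  psd (fun a b => expR (- `|g a - g b| ^+ 2)).
Proof.
move=> [dot normE].
rewrite (_ : (fun _ _ => _) = (fun a b =>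
    (expR (- `|g a| ^+ 2) * expR (- `|g b| ^+ 2))
    * expR (2 * dot (g a) (g b)))).
  apply: psdM; first exact: psd_rank1.
  by apply: psd_expR; apply: psdZ => //; apply: psd_gram.
apply/funext => a; apply/funext => b; rewrite -!expRD -!(dot_self normE).
by congr expR; rewrite hnormB expr0 /=; ring.
Qed.

Lemma gaussian_bounds (R : realType) (x : R) :
  [/\ 0 <= expR (- x ^+ 2), expR (- x ^+ 2) <= 1 & 1 - expR (- x ^+ 2) <= x ^+ 2].
Proof.
split; first exact: expR_ge0.
  by rewrite expR_le1 oppr_le0 sqr_ge0.
by have := expR_ge1Dx (- x ^+ 2); lra.
Qed.

Lemma gaussian_le_half (R : realType) (x : R) : 1 <= x -> expR (- x ^+ 2) <= 1 / 2.
Proof.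
move=> x1; have h : 1 + x ^+ 2 <= expR (x ^+ 2) by apply: expR_ge1Dx.
have x2 : 1 <= x ^+ 2 by rewrite expr_ge1 // (le_trans ler01).
by rewrite expRN div1r lef_pV2 ?posrE ?expR_gt0 //; lra.
Qed.

(* A discrete substitute for Bochner's theorem: averaging the Gaussian kernel
   over a large box makes it translation invariant up to boundary effects. *)
Lemma spectral_measure (R : realType) (X : normedModType R)
    (H : completeNormedModType R) (f : X -> H) (K Delta : R) (n : nat)
    (u : 'I_n -> X) (delta : R) (B : nat) :
  is_hilbert H ->
  (forall x1 x2 : X, `|f x1 - f x2| <= K * Num.sqrt `|x1 - x2|) ->
  (forall x1 x2 : X, Delta <= `|x1 - x2| -> 1 <= `|f x1 - f x2|) ->
  0 < delta ->
  exists (T : finType) (w : T -> R) (th : T -> 'I_n -> R),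
    [/\ forall t, 0 <= w t, \sum_t w t = 1, forall t j, `|th t j| <= pi &
    forall k : 'I_n -> int, (\sum_j `|k j| <= B)%N ->
      \sum_t w t * (1 - cos (int_dot k (th t)))
        <= K ^+ 2 * `|\sum_j (k j)%:~R *: u j| + delta /\
      (Delta <= `|\sum_j (k j)%:~R *: u j| ->
       1 / 2 - delta <= \sum_t w t * (1 - cos (int_dot k (th t))))].
Proof.
move=> hH fK fD d0.
(* The side [N.+2] of the box exceeds [B / delta], so a shift of total size at most [B] wraps a
   fraction of at most [delta] of its points. *)
pose N := `|Num.truncn (B%:R / delta)|%N.
have NB : B%:R / N.+2%:R <= delta.
  rewrite ler_pdivrMr ?ltr0n // mulrC -ler_pdivrMr //.
  apply: ltW; apply: lt_trans (truncnS_gt _) _; rewrite ltr_nat.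
  by rewrite ltnS /N absz_nat.
pose iota (a : torus n N) : X := \sum_j (a j : nat)%:R *: u j.
pose G (a b : torus n N) := expR (- `|f (iota a) - f (iota b)| ^+ 2).
have pG : psd G by apply: psd_gaussian.
set T := #|{: torus n N}|%:R : R; have T0 : 0 < T := card_torus_gt0 R n N.
have mass1 : \sum_t spectral_weight G t = 1.
  transitivity (\sum_t spectral_weight G t * zcos R (zpair 0 t)).
    apply: eq_bigr => t _; rewrite /zpair big1 ?zcos0 ?mulr1 // => j _.
    by rewrite ffunE mul0r.
  rewrite spectral_weight_cos; last exact: pG.1.
  under eq_bigr => b _ do rewrite addr0 /G subrr normr0 expr0n oppr0 expR0.
  by rewrite sumr_const -/T divff // lt0r_neq0.
exists (torus n N), (spectral_weight G), (@torus_angle R n N); split.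
- by move=> t; apply: spectral_weight_ge0.
- exact: mass1.
- exact: torus_angle_le_pi.
move=> k kB; set x := \sum_j (k j)%:~R *: u j.
pose r := residues N k.
have energyE : \sum_t spectral_weight G t * (1 - cos (int_dot k (torus_angle R t))) =
    (\sum_(b : torus n N) (1 - G (b + r) b)) / T.
  under eq_bigr => t _ do rewrite mulrBr mulr1 cos_int_dot.
  rewrite sumrB mass1 spectral_weight_cos; last exact: pG.1.
  rewrite sumrB sumr_const.
  by rewrite -/T mulrBl divff // lt0r_neq0.
suff : (\sum_(b : torus n N) (1 - G (b + r) b)) / T <= K ^+ 2 * `|x| + delta /\
    (Delta <= `|x| -> 1 / 2 - delta <= (\sum_(b : torus n N) (1 - G (b + r) b)) / T).
  by rewrite -energyE.
pose bad (b : torus n N) : R := (~~ [forall j, stays k b j])%:R.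
have wrap : \sum_b bad b <= T * delta.
  apply: le_trans (wrap_fraction R N k) _; rewrite ler_wpM2l ?(ltW T0) //.
  by apply: le_trans NB; rewrite ler_wpM2r ?invr_ge0 ?ler_nat.
have shift b : [forall j, stays k b j] -> iota (b + r) - iota b = x.
  move=> /forallP st; rewrite -sumrB; apply: eq_bigr => j _.
  rewrite -scalerBl; congr (_ *: _); rewrite !pmulrn residues_stays //.
  by rewrite intrD addrAC subrr add0r.
split=> [|xD].
  rewrite ler_pdivrMr // mulrDl [_ * T]mulrC [delta * T]mulrC.
  (* A pair that does not wrap differs by exactly [x], so the hypothesis on [f] applies; a wrapped
     pair contributes at most 1. *)
  apply: (@le_trans _ _ (\sum_b (K ^+ 2 * `|x| + bad b))).
    apply: ler_sum => b _.
    have [G0 G1 G2] := gaussian_bounds `|f (iota (b + r)) - f (iota b)|.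
    rewrite /bad; case: (boolP [forall j, _]) => [st|_] /=; last first.
      have ? : 0 <= K ^+ 2 * `|x| by rewrite mulr_ge0 ?sqr_ge0.
      by rewrite /G; lra.
    rewrite addr0; apply: le_trans G2 _.
    have := fK (iota (b + r)) (iota b); rewrite shift // => h.
    apply: (@le_trans _ _ ((K * Num.sqrt `|x|) ^+ 2)).
      by rewrite ler_sqr ?nnegrE // (le_trans _ h).
    by rewrite exprMn sqr_sqrtr.
  rewrite big_split; apply: lerD; last exact: wrap.
  by rewrite sumr_const -mulr_natl.
rewrite ler_pdivlMr // mulrBl ![_ * T]mulrC.
apply: (@le_trans _ _ (\sum_b (1 / 2 - bad b))).
  rewrite sumrB; apply: lerB; last exact: wrap.
  by rewrite sumr_const [leLHS]mulr_natl.
apply: ler_sum => b _.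
have [G0 G1 G2] := gaussian_bounds (`|f (iota (b + r)) - f (iota b)|).
rewrite /bad; case: (boolP [forall j, _]) => [st|_] /=; last by rewrite /G; lra.
rewrite -(shift b st) in xD.
by have := gaussian_le_half (fD _ _ xD); rewrite /G; lra.
Qed.

(** * Comparison of p-th powers with cosines *)

Lemma powR_ge1 (R : realType) (p x : R) : 0 <= p -> 1 <= x -> 1 <= x `^ p.
Proof.
move=> p0 x1; have <- : 1 `^ p = 1 :> R by rewrite powR1.
by apply: ge0_ler_powR; rewrite ?nnegrE ?(le_trans ler01 x1).
Qed.

Lemma powR_le1 (R : realType) (p x : R) :
  0 <= p -> 0 <= x -> x <= 1 -> x `^ p <= 1.
Proof.
move=> p0 x0 x1; have <- : 1 `^ p = 1 :> R by rewrite powR1.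
by apply: ge0_ler_powR; rewrite ?nnegrE.
Qed.

(** The shares [c / (a + b)] of the two terms lie in [[0, 1]], hence are at most their [p]-th
    powers, and they add up to 1. *)
Lemma powR_norm_subadd (R : realType) (p x y : R) : 0 < p -> p <= 1 ->
  `|x + y| `^ p <= `|x| `^ p + `|y| `^ p.
Proof.
move=> p0 p1; set a := `|x|; set b := `|y|.
have a0 : 0 <= a by rewrite normr_ge0.
have b0 : 0 <= b by rewrite normr_ge0.
apply: (@le_trans _ _ ((a + b) `^ p)).
  by apply: ge0_ler_powR; rewrite ?nnegrE ?addr_ge0 ?ler_normD // ltW.
have [->|s0] := eqVneq (a + b) 0; first by rewrite powR0 ?addr_ge0 ?powR_ge0 ?gt_eqF.
have sp : 0 < a + b by rewrite lt_neqAle eq_sym s0 addr_ge0.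
have part c : 0 <= c -> c <= a + b -> (a + b) `^ p * (c / (a + b)) <= c `^ p.
  move=> c0 cs; have [->|cn] := eqVneq c 0; first by rewrite mul0r mulr0 powR_ge0.
  have cp : 0 < c by rewrite lt_neqAle eq_sym cn c0.
  rewrite -[in leRHS](divfK s0 c) [in leRHS]mulrC powRM ?divr_ge0 ?(ltW sp) //.
  rewrite ler_wpM2l ?powR_ge0 // ger1_powR // divr_gt0 //=.
  by rewrite ler_pdivrMr // mul1r.
apply: le_trans (lerD (part a a0 _) (part b b0 _)); rewrite ?lerDl ?lerDr //.
by rewrite -mulrDr -mulrDl divff // mulr1.
Qed.

Lemma norm_sin_le (R : realType) (x : R) : `|sin x| <= `|x|.
Proof.
wlog x0 : x / 0 < x => [hw|].
  have [x0|x0|->] := ltgtP x 0; [|exact: hw|by rewrite sin0].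
  by rewrite -normrN -sinN -[leRHS]normrN; apply: hw; rewrite oppr_gt0.
have [|c _] := @MVT R sin cos 0 x x0 (fun y _ => is_derive_sin y).
  by apply: continuous_subspaceT; exact: continuous_sin.
rewrite sin0 !subr0 => ->; rewrite normrM ler_piMl //.
exact: cos_max.
Qed.

Lemma one_sub_cos_le_powR (R : realType) (p y : R) : 0 < p -> p <= 1 ->
  1 - cos y <= 2 * `|y| `^ p.
Proof.
move=> p0 p1; have [y1|y1] := lerP `|y| 1; last first.
  have : 1 <= `|y| `^ p by rewrite powR_ge1 // ltW.
  by have := cos_geN1 y; lra.
have [->|yn] := eqVneq y 0; first by rewrite cos0 subrr mulr_ge0 ?powR_ge0.
have yp : `|y| <= `|y| `^ p by rewrite ger1_powR // normr_gt0 yn.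
have h := norm_sin_le (y / 2); have h1 := sin_max (y / 2).
rewrite one_sub_cos; apply: (@le_trans _ _ (2 * `|sin (y / 2)|)).
  rewrite ler_wpM2l // -real_normK ?num_real // expr2 ler_piMl //.
rewrite normrM (ger0_norm (_ : 0 <= 2^-1)) // in h.
by have y0 := normr_ge0 y; lra.
Qed.

Lemma cos_half_lt1 (R : realType) : cos (1 / 2 : R) < 1.
Proof.
have pi2 : 2 <= pi :> R by exact: pi_ge2.
rewrite -[X in _ < X]cos0 ltr_cos ?in_itv /=; lra.
Qed.

(** If [|y| <= 1] the constant 1 suffices. Otherwise some scale has [2 ^ (j - 1) < |y| <= 2 ^ j];
    then [y / 2 ^ j] has absolute value in [[1/2, 1]], and this single term already dominates. *)
Lemma powR_norm_le_cos_sum (R : realType) (p y : R) (J : nat) : 0 < p ->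
  `|y| <= 2 ^+ J ->
  `|y| `^ p <= 1 + (1 - cos (1 / 2))^-1 *
     \sum_(j < J.+1) (2 ^+ j) `^ p * (1 - cos (y / 2 ^+ j)).
Proof.
move=> p0; set c := 1 - cos (1 / 2).
have c0 : 0 < c by rewrite subr_gt0 cos_half_lt1.
have pi2 : 2 <= pi :> R by exact: pi_ge2.
have t0 (j : nat) : 0 <= (2 ^+ j) `^ p * (1 - cos (y / 2 ^+ j)).
  by rewrite mulr_ge0 ?powR_ge0 // subr_ge0 cos_le1.
elim: J => [|J IHJ] yJ.
  rewrite expr0 in yJ; rewrite -[leLHS]addr0 lerD //.
    by rewrite powR_le1 // ltW.
  by rewrite mulr_ge0 ?invr_ge0 ?(ltW c0) // sumr_ge0.
rewrite big_ord_recr /= mulrDr addrA; have [/IHJ h|yJ'] := lerP `|y| (2 ^+ J).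
  by apply: le_trans h _; rewrite lerDl mulr_ge0 // invr_ge0 ltW.
have P0 : 0 < 2 ^+ J.+1 :> R by rewrite exprn_gt0.
have S0 : 0 <= c^-1 * \sum_(j < J.+1) (2 ^+ j) `^ p * (1 - cos (y / 2 ^+ j)).
  by rewrite mulr_ge0 ?invr_ge0 ?(ltW c0) // sumr_ge0.
apply: (@le_trans _ _ (c^-1 * ((2 ^+ J.+1) `^ p * (1 - cos (y / 2 ^+ J.+1))))).
  2: by lra.
apply: (@le_trans _ _ ((2 ^+ J.+1) `^ p)).
  by rewrite ge0_ler_powR ?nnegrE // ltW.
rewrite mulrCA ler_peMr ?powR_ge0 // mulrC ler_pdivlMr // mul1r lerB //.
have -> : cos (y / 2 ^+ J.+1) = cos (`|y| / 2 ^+ J.+1).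
  by have [//|_] := ger0P y; rewrite mulNr cosN.
have z1 : `|y| / 2 ^+ J.+1 <= 1 by rewrite ler_pdivrMr // mul1r.
have z2 : 1 / 2 <= `|y| / 2 ^+ J.+1.
  rewrite ler_pdivlMr // exprS; move: yJ'; lra.
have [->//|zn] := eqVneq (`|y| / 2 ^+ J.+1) (1 / 2).
by rewrite ltW // ltr_cos ?in_itv /=; lra.
Qed.

Lemma sum_geometric_le (R : realType) (q : R) (n : nat) : 0 <= q -> q < 1 ->
  \sum_(j < n) q ^+ j <= (1 - q)^-1.
Proof.
move=> q0 q1; have d0 : 0 < 1 - q by rewrite subr_gt0.
rewrite -[leRHS]mul1r ler_pdivlMr // mulrC.
have -> : (1 - q) * \sum_(j < n) q ^+ j = 1 - q ^+ n.
  by rewrite -[in RHS](expr1n _ n) subrXX; congr (_ * _);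
     apply: eq_bigr => i _; rewrite expr1n mul1r.
by rewrite lerBlDr lerDl exprn_ge0.
Qed.

(** A geometric series of ratio [2 ^ (- eps)], whose distance to 1 is at least [eps / 3]. This is
    the origin of the factor [1 / eps]. *)
Lemma dyadic_sum_le (R : realType) (eps : R) (n : nat) : 0 < eps -> eps < 1 ->
  \sum_(j < n) (2 ^+ j) `^ (1 - eps) / 2 ^+ j <= 3 / eps.
Proof.
move=> e0 e1; pose q : R := 2 `^ (- eps).
have q0 : 0 < q by rewrite powR_gt0.
have h2 : expR (1 / 2) <= 2 :> R.
  have := expR_ge1Dx (- (1 / 2) : R); rewrite expRN => h.
  have E0 := expR_gt0 (1 / 2 : R).
  have : (1 + - (1 / 2)) * expR (1 / 2) <= 1 :> R.
    by rewrite -ler_pdivlMr // [leRHS]div1r.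
  by lra.
have qi : 1 + eps / 2 <= q^-1.
  rewrite /q powRN invrK.
  apply: (@le_trans _ _ (expR (1 / 2) `^ eps)).
    by rewrite -expRM; apply: le_trans (expR_ge1Dx _); lra.
  by rewrite ge0_ler_powR ?nnegrE ?expR_ge0 // ltW.
have qle : q * (1 + eps / 2) <= 1 by rewrite mulrC -ler_pdivlMr // [leRHS]div1r.
have qe : eps / 3 <= 1 - q by nra.
have q1 : q < 1 by lra.
have -> : \sum_(j < n) (2 ^+ j) `^ (1 - eps) / 2 ^+ j = \sum_(j < n) q ^+ j.
  apply: eq_bigr => j _; have P0 : 0 < 2 ^+ j :> R by rewrite exprn_gt0.
  rewrite powRD; last by rewrite (gt_eqF P0) implybT.
  rewrite powRr1 ?(ltW P0) // mulrAC divff ?gt_eqF // mul1r.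
  transitivity (2 `^ (j%:R * - eps)).
    by rewrite powRrM powR_mulrn.
  by rewrite mulrC powRrM powR_mulrn // powR_ge0.
apply: le_trans (sum_geometric_le _ (ltW q0) q1) _.
by rewrite -[3 / eps]invf_div lef_pV2 ?posrE ?divr_gt0 //; lra.
Qed.

(** * Moments of the spectral measure *)

Lemma int_dotZ (R : realType) (n : nat) (c : int) (k : 'I_n -> int)
    (th : 'I_n -> R) :
  int_dot (fun j => c * k j) th = c%:~R * int_dot k th.
Proof.
by rewrite /int_dot mulr_sumr; apply: eq_bigr => j _; rewrite intrM mulrA.
Qed.

Lemma int_dot_delta (R : realType) (n : nat) (i : 'I_n) (th : 'I_n -> R) :
  int_dot (fun j => (j == i)%:Z) th = th i.
Proof.
rewrite /int_dot (bigD1 i) //= eqxx mul1r big1 ?addr0 // => j /negbTE ->.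
by rewrite mul0r.
Qed.

Lemma norm_int_dot_le (R : realType) (n L : nat) (m : 'I_n -> int)
    (th : 'I_n -> R) (r : R) :
  (forall j, (`|m j| <= L)%N) -> (forall j, `|th j| <= r) ->
  `|int_dot m th| <= (n * L)%:R * r.
Proof.
move=> mL thr; apply: le_trans (ler_norm_sum _ _ _) _.
apply: (@le_trans _ _ (\sum_(j < n) L%:R * r)).
  apply: ler_sum => j _; rewrite normrM ler_pM //.
  by rewrite -intr_norm -abszE -pmulrn ler_nat.
by rewrite sumr_const card_ord -mulrnAl natrM mulr_natl.
Qed.

Lemma exists_half_pow_le (R : realType) (e : R) : 0 < e ->
  exists J : nat, 2 ^- J <= e.
Proof.
move=> e0; pose J := Num.truncn e^-1; exists J.+1.
rewrite -[leRHS]invrK lef_pV2 ?posrE ?exprn_gt0 ?invr_gt0 //.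
apply: ltW; apply: lt_le_trans (truncnS_gt _) _.
by rewrite -natrX ler_nat ltnW // ltn_expl.
Qed.

(** Combines the constants of [powR_norm_le_cos_sum] and [dyadic_sum_le]; over [eps], it bounds the
    moments before scaling by [s]. *)
Definition dyadic_const (R : realType) : R := 1 + 3 / (1 - cos (1 / 2)).

Lemma dyadic_const_gt1 (R : realType) : 1 < dyadic_const R.
Proof. by rewrite ltrDl divr_gt0 // subr_gt0 cos_half_lt1. Qed.

Definition energy (R : realType) (T : finType) (n : nat) (w : T -> R)
    (th : T -> 'I_n -> R) (k : 'I_n -> int) : R :=
  \sum_t w t * (1 - cos (int_dot k (th t))).

(** Restricting to small angles bounds [int_dot m (th t)] for bounded [m], so that finitely many
    dyadic scales suffice. *)
Definition small_angles (R : realType) (T : finType) (n : nat)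
    (th : T -> 'I_n -> R) (r : R) (t : T) : bool :=
  [forall j, `|th t j| <= r].

(** Markov's inequality: an angle with [|th t j| > r] adds at least [1 - cos r] to the integrand of
    the energy of the [j]-th unit vector. *)
Lemma large_angles_mass (R : realType) (T : finType) (n : nat) (w : T -> R)
    (th : T -> 'I_n -> R) (r : R) :
  (forall t, 0 <= w t) -> 0 < r -> r <= pi ->
  (forall t j, `|th t j| <= pi) ->
  \sum_t w t * (~~ small_angles th r t)%:R
    <= (\sum_i energy w th (fun j => (j == i)%:Z)) / (1 - cos r).
Proof.
move=> w0 r0 rpi thpi.
have c0 : 0 < 1 - cos r.
  rewrite subr_gt0 -[X in _ < X]cos0.
  by rewrite ltr_cos ?in_itv /= ?lexx ?pi_ge0 ?(ltW r0).
rewrite ler_pdivlMr // mulr_suml /energy exchange_big; apply: ler_sum => t _.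
have p0 j : 0 <= w t * (1 - cos (th t j)) by rewrite mulr_ge0 // subr_ge0 cos_le1.
under eq_bigr => i _ do rewrite int_dot_delta.
rewrite -mulrA; case: (boolP (small_angles th r t)) => [_|/forallPn[j]] /=.
  by rewrite mul0r mulr0 sumr_ge0.
rewrite -ltNge mul1r => rj; rewrite (bigD1 j) //=.
apply: (@le_trans _ _ (w t * (1 - cos (th t j)))); last by rewrite lerDl sumr_ge0.
rewrite ler_wpM2l // lerB //.
have -> : cos (th t j) = cos `|th t j| by have [//|_] := ger0P (th t j); rewrite cosN.
by rewrite ltW // ltr_cos ?in_itv //= ?normr_ge0 ?thpi // (ltW r0).
Qed.

(** The dyadic cosine bound is applied to [2 ^ J * int_dot m (th t)], at most [2 ^ J] in size on
    small angles. Its term at scale [j] integrates to the energy of [2 ^ (J - j) * m], at most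
    [2 ^ (- j)]. *)
Lemma small_angles_moment_le (R : realType) (T : finType) (n : nat) (w : T -> R)
    (th : T -> 'I_n -> R) (p r : R) (L J : nat) (m : 'I_n -> int) :
  (forall t, 0 <= w t) -> \sum_t w t = 1 -> 0 < p ->
  (n * L)%:R * r <= 1 -> (forall j, (`|m j| <= L)%N) ->
  (forall i, (i <= J)%N ->
     energy w th (fun j => (2 ^ i)%:Z * m j) <= 2 ^+ i / 2 ^+ J) ->
  \sum_t w t * (small_angles th r t)%:R * `|2 ^+ J * int_dot m (th t)| `^ p
    <= 1 + (1 - cos (1 / 2))^-1 * \sum_(j < J.+1) (2 ^+ j) `^ p / 2 ^+ j.
Proof.
move=> w0 w1 p0 nLr mL en; set c := (_ - cos (1 / 2))^-1.
have c0 : 0 <= c by rewrite invr_ge0 subr_ge0 cos_le1.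
apply: (@le_trans _ _ (\sum_t w t * (1 + c * \sum_(j < J.+1)
    (2 ^+ j) `^ p * (1 - cos (2 ^+ J * int_dot m (th t) / 2 ^+ j))))).
  apply: ler_sum => t _; rewrite -mulrA ler_wpM2l //.
  case: (boolP (small_angles th r t)) => [/forallP st|_] /=.
    rewrite mul1r powR_norm_le_cos_sum // normrM ger0_norm ?exprn_ge0 //.
    by rewrite ler_piMr ?exprn_ge0 // (le_trans (norm_int_dot_le mL st)).
  rewrite mul0r; apply: addr_ge0 => //; apply: mulr_ge0 => //.
  apply: sumr_ge0 => j _.
  by rewrite mulr_ge0 ?powR_ge0 // subr_ge0 cos_le1.
under eq_bigr => t _ do rewrite mulrDr mulr1 mulrCA mulr_sumr.
rewrite big_split /= w1 lerD2l -mulr_sumr ler_wpM2l // exchange_big /=.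
apply: ler_sum => j _.
under eq_bigr => t _ do rewrite mulrCA.
rewrite -mulr_sumr ler_wpM2l ?powR_ge0 //.
have jJ : (j <= J)%N by rewrite -ltnS.
have := en (J - j)%N (leq_subr _ _).
have n2 : (2 : R) != 0 by rewrite pnatr_eq0.
rewrite -[X in _ / 2 ^+ X](subnK jJ) exprD invfM mulrA divff ?expf_neq0 // mul1r.
congr (_ <= _); apply: eq_bigr => t _; rewrite int_dotZ; congr (_ * (1 - cos _)).
rewrite mulrAC -[X in 2 ^+ X](subnK jJ) exprD mulfK ?expf_neq0 //.
by rewrite -pmulrn natrX.
Qed.

Lemma small_angles_moment_ge (R : realType) (T : finType) (n : nat) (w : T -> R)
    (th : T -> 'I_n -> R) (p r c e : R) (k : 'I_n -> int) :
  (forall t, 0 <= w t) -> 0 < p -> p <= 1 -> c <= energy w th k ->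
  \sum_t w t * (~~ small_angles th r t)%:R <= e ->
  c / 2 - e <= \sum_t w t * (small_angles th r t)%:R * `|int_dot k (th t)| `^ p.
Proof.
move=> w0 p0 p1 ck be; set S := \sum_t _.
suff : energy w th k <= 2 * S + 2 * \sum_t w t * (~~ small_angles th r t)%:R by lra.
rewrite !mulr_sumr -big_split; apply: ler_sum => t _ /=.
rewrite -mulrA [2 * _]mulrCA [2 * (w t * _)]mulrCA -mulrDr ler_wpM2l //.
case: small_angles => /=; rewrite ?mul0r ?mul1r ?mulr0 ?mulr1 ?addr0 ?add0r.
  exact: one_sub_cos_le_powR.
by have := cos_geN1 (int_dot k (th t)); lra.
Qed.

Lemma lattice_moments (R : realType) (X : normedModType R)
    (H : completeNormedModType R) (f : X -> H) (K Delta eps : R) (s n L : nat)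
    (g : 'I_n -> X) :
  is_hilbert H ->
  (forall x1 x2 : X, `|f x1 - f x2| <= K * Num.sqrt `|x1 - x2|) ->
  (forall x1 x2 : X, Delta <= `|x1 - x2| -> 1 <= `|f x1 - f x2|) ->
  0 < Delta -> 0 < eps -> eps < 1 -> 3 * K ^+ 2 * Delta + 1 <= s%:R ->
  (forall j, `|g j| <= 3 * Delta) ->
  exists (T : finType) (w : T -> R) (v : T -> 'I_n -> R),
    (forall t, 0 <= w t) /\
    forall m : 'I_n -> int, (forall j, (`|m j| <= L)%N) ->
      (`|\sum_j (m j)%:~R *: g j| <= 3 * Delta ->
        \sum_t w t * `|int_dot m (v t)| `^ (1 - eps)
          <= s%:R `^ (1 - eps) * (dyadic_const R / eps)) /\
      (Delta <= `|\sum_j (m j)%:~R *: g j| ->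
        1 / 16 <= \sum_t w t * `|int_dot m (v t)| `^ (1 - eps)).
Proof.
move=> hH fK fD D0 e0 e1 sK gD.
have p0 : 0 < 1 - eps by rewrite subr_gt0.
have p1 : 1 - eps <= 1 by rewrite gerBl ltW.
have KD0 : 0 <= 3 * K ^+ 2 * Delta by rewrite mulr_ge0 ?(ltW D0) // mulr_ge0 ?sqr_ge0.
have s1 : 1 <= s%:R :> R by apply: le_trans sK; rewrite lerDr.
have s0 : 0 < s%:R :> R := lt_le_trans ltr01 s1.
(* Small angles then give [|int_dot m (th t)| <= 1] for all [m] with entries at most [L]. *)
pose r : R := (n * L).+1%:R^-1.
have r0 : 0 < r by rewrite invr_gt0 ltr0n.
have r1 : r <= 1 by rewrite invf_le1 ?ltr0n ?ler1n.
have pi2 : 2 <= pi :> R by exact: pi_ge2.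
have rpi : r <= pi by lra.
have nLr : (n * L)%:R * r <= 1.
  by rewrite ler_pdivrMr ?ltr0n // mul1r ler_nat leqnSn.
have c0 : 0 < 1 - cos r.
  by rewrite subr_gt0 -[X in _ < X]cos0 ltr_cos ?in_itv /= ?lexx ?pi_ge0 ?(ltW r0).
(* [J] is so large that the energies of the generators [u], at most [2 ^- J] each, force the large
   angles to have mass at most [1 / 8]. *)
have [J0 hJ0] : exists J : nat, 2 ^- J <= (1 - cos r) / (16 * n.+1%:R) :> R.
  by apply: exists_half_pow_le; rewrite divr_gt0 // mulr_gt0 // ltr0n.
have [J hJ hJ8] : exists2 J : nat, 2 ^- J <= (1 - cos r) / (16 * n.+1%:R) :> R
    & 2 ^- J <= 1 / 8 :> R.
  exists J0 => //; apply: le_trans hJ0 _.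
  have n1 : 1 <= n.+1%:R :> R by rewrite ler1n.
  rewrite ler_pdivrMr ?mulr_gt0 ?ltr0n //.
  by have := cos_geN1 r; lra.
have P0 : 0 < 2 ^+ J :> R by rewrite exprn_gt0.
pose c : R := s%:R * 2 ^+ J.
have cp : 0 < c by rewrite mulr_gt0.
pose u j := c^-1 *: g j.
pose delta : R := 2 ^- J / s%:R.
have d0 : 0 < delta by rewrite divr_gt0 // invr_gt0.
have deltaE : delta = c^-1 by rewrite /delta /c invfM mulrC.
(* Here [s] absorbs both the upper constant [3 * K ^+ 2 * Delta] and the error [delta]. *)
have key (q A : R) : 1 <= q -> A <= 3 * Delta ->
    K ^+ 2 * (q / c * A) + delta <= q / 2 ^+ J.
  move=> q1 A3; have -> : q / 2 ^+ J = q / c * s%:R.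
    by rewrite /c; field; rewrite ?gt_eqF.
  have qc : 0 <= q / c by rewrite divr_ge0 ?(ltW cp) ?(le_trans ler01 q1).
  apply: (@le_trans _ _ (q / c * (3 * K ^+ 2 * Delta + 1))).
    rewrite mulrDr mulr1 lerD //.
      rewrite mulrCA ler_wpM2l // -mulrA mulrCA ler_wpM2l ?sqr_ge0 //.
    by rewrite deltaE ler_peMl // invr_ge0 ltW.
  by rewrite ler_wpM2l.
pose B := (n * (s * 2 ^ J * L)).+1.
have [T [w [th [w0 w1 thpi spec]]]] :=
  @spectral_measure R X H f K Delta n u delta B hH fK fD d0.
have uE (q : nat) (m : 'I_n -> int) :
    \sum_j ((q%:Z * m j)%:~R) *: u j = (q%:R / c) *: \sum_j (m j)%:~R *: g j.
  rewrite scaler_sumr; apply: eq_bigr => j _.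
  by rewrite /u !scalerA intrM -pmulrn mulrAC.
have inB (q : nat) (m : 'I_n -> int) : (forall j, (`|m j| <= L)%N) ->
    (q <= s * 2 ^ J)%N -> (\sum_j `|(q%:Z * m j)%R| <= B)%N.
  move=> mL qs; apply: leqW; apply: (@leq_trans (\sum_(j < n) (s * 2 ^ J * L))).
    by apply: leq_sum => j _; rewrite abszM leq_mul.
  by rewrite sum_nat_const card_ord.
have normE (q : nat) (x : X) : `|(q%:R / c) *: x| = q%:R / c * `|x|.
  by rewrite normrZ ger0_norm ?divr_ge0 ?(ltW cp).
have Edelta i : energy w th (fun j => (j == i)%:Z) <= 2 ^- J.
  have [|h _] := spec (fun j => (j == i)%:Z).
    rewrite (bigD1 i) //= eqxx big1 // => j /negbTE -> //.
  apply: le_trans h _.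
  rewrite (bigD1 i) //= eqxx big1 ?addr0; last first.
    by move=> j /negbTE ->; rewrite scale0r.
  rewrite scale1r /u normrZ ger0_norm ?invr_ge0 ?(ltW cp) //.
  by have := key 1 `|g i| (lexx _) (gD i); rewrite !div1r.
have Epow m i : (forall j, (`|m j| <= L)%N) ->
    `|\sum_j (m j)%:~R *: g j| <= 3 * Delta -> (i <= J)%N ->
    energy w th (fun j => (2 ^ i)%:Z * m j) <= 2 ^+ i / 2 ^+ J.
  move=> mL mD iJ; have [|h _] := spec (fun j => (2 ^ i)%:Z * m j).
    apply: inB => //; apply: (@leq_trans (2 ^ J)); first by rewrite leq_pexp2l.
    by rewrite leq_pmull // -(ltr0n R).
  apply: le_trans h _; rewrite uE normE natrX.
  by apply: key => //; rewrite exprn_ege1 // ler1n.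
(* Large angles get weight zero; scaling by [c] turns functionals on the coordinates over [u] into
   functionals on those over [g]. *)
exists T, (fun t => w t * (small_angles th r t)%:R), (fun t j => c * th t j).
have dotE m t : int_dot m (fun j => c * th t j) = s%:R * (2 ^+ J * int_dot m (th t)).
  rewrite mulrA -/c /int_dot mulr_sumr; apply: eq_bigr => j _.
  by rewrite mulrCA.
split=> [t|m mL]; first by rewrite mulr_ge0.
split=> [mD|mD].
  have := @small_angles_moment_le R T n w th (1 - eps) r L J m w0 w1 p0 nLr mL
    (fun i iJ => Epow m i mL mD iJ).
  move=> h.
  have -> : \sum_t w t * (small_angles th r t)%:R
        * `|int_dot m (fun j => c * th t j)| `^ (1 - eps) =
      s%:R `^ (1 - eps) * \sum_t w t * (small_angles th r t)%:R
        * `|2 ^+ J * int_dot m (th t)| `^ (1 - eps).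
    rewrite mulr_sumr; apply: eq_bigr => t _; rewrite dotE normrM.
    by rewrite powRM // ger0_norm ?(ltW s0) // mulrCA.
  rewrite ler_wpM2l ?powR_ge0 //; apply: le_trans h _.
  have e3 := dyadic_sum_le J.+1 e0 e1.
  have ch : 0 < 1 - cos (1 / 2 : R) by rewrite subr_gt0 cos_half_lt1.
  rewrite /dyadic_const mulrDl lerD //.
    by rewrite ?div1r invf_ge1 // ltW.
  rewrite [leRHS](_ : _ = (1 - cos (1 / 2))^-1 * (3 / eps)).
    by rewrite ler_wpM2l // invr_ge0 ltW.
  by rewrite mulrAC mulrC.
have ck : 1 / 2 - 1 / 8 <= energy w th (fun j => (s * 2 ^ J)%N%:Z * m j).
  have [|_ h] := spec (fun j => (s * 2 ^ J)%N%:Z * m j).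
    by apply: inB.
  apply: le_trans (h _); last first.
    by rewrite uE normE natrM natrX divff ?gt_eqF // mul1r.
  rewrite lerD2l lerN2; apply: le_trans hJ8.
  by rewrite /delta ler_piMr ?invr_ge0 ?(ltW P0) // invf_le1.
have be : \sum_t w t * (~~ small_angles th r t)%:R <= 1 / 8.
  apply: le_trans (large_angles_mass w0 r0 rpi thpi) _.
  rewrite ler_pdivrMr //.
  apply: (@le_trans _ _ (\sum_(i < n) 2 ^- J)); first by apply: ler_sum => i _.
  rewrite sumr_const card_ord -[leLHS]mulr_natl.
  apply: (@le_trans _ _ (n.+1%:R * 2 ^- J)).
    by rewrite ler_wpM2r ?invr_ge0 ?(ltW P0) // ler_nat.
  rewrite ler_pdivlMr ?mulr_gt0 ?ltr0n // in hJ.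
  by lra.
have := small_angles_moment_ge w0 p0 p1 ck be.
move=> h; apply: le_trans (_ : (1 / 2 - 1 / 8) / 2 - 1 / 8 <= _); first by lra.
apply: le_trans h _; rewrite le_eqVlt; apply/orP; left; apply/eqP.
apply: eq_bigr => t _; rewrite int_dotZ dotE -pmulrn natrM natrX.
by rewrite mulrA.
Qed.

(** * Coordinates in a finite-dimensional normed space *)

(** The norm of the combination is continuous and positive on the compact unit sphere of coefficient
    vectors; [M] is the inverse of its minimum, or 0 when the sphere is empty. *)
Lemma coord_bound (R : realType) (X : normedModType R) (n : nat)
    (b : 'I_n -> X) :
  (forall v : 'rV[R]_n, \sum_j v 0 j *: b j = 0 -> v = 0) ->
  exists2 M : R, 0 <= M & forall (v : 'rV[R]_n) j,
    `|v 0 j| <= M * `|\sum_j v 0 j *: b j|.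
Proof.
move=> bfree; pose phi (v : 'rV[R]_n) := `|\sum_j v 0 j *: b j|.
have entry (v : 'rV[R]_n) j : `|v 0 j| <= `|v|.
  rewrite [leRHS]/Num.norm /= mx_normrE; apply/bigmax_geP; right => /=.
  by exists (0, j).
have phiZ a v : phi (a *: v) = `|a| * phi v.
  rewrite /phi -normrZ scaler_sumr; congr `|_|; apply: eq_bigr => j _.
  by rewrite mxE scalerA.
have [n0|/existsNP[v0 v00]] := pselect (forall v : 'rV[R]_n, v = 0).
  by exists 0 => // v j; rewrite (n0 v) mxE normr0 mul0r.
pose S := [set v : 'rV[R]_n | `|v| = 1]%classic.
have unit (v : 'rV[R]_n) : v != 0 -> S (`|v|^-1 *: v).
  by move=> vn0; rewrite /S /= normrZ normfV normr_id mulVf ?normr_eq0.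
have Scompact : compact S.
  apply: bounded_closed_compact.
    by exists 1; split => // r r1 v /= ->; exact: ltW.
  rewrite (_ : S = Num.norm @^-1` [set x | x = 1])%classic //.
  apply: preimage_closed; last exact: closed_eq.
  by move=> v _; exact: norm_continuous.
have sum_cont : continuous (fun v : 'rV[R]_n => \sum_j v 0 j *: b j).
  move=> v; apply: (@cvg_big _ _ _ _ _ _ _ _ _ _ _ (nbhs_filter v)) => [|j _].
    exact: add_continuous.
  by apply: cvgZr_tmp; exact: coord_continuous.
have phi_cont : continuous phi by move=> v; exact: (cvg_norm (sum_cont v)).
have [||c cS cmin] := @EVT_min_rV R n phi S _ Scompact.
- by exists (`|v0|^-1 *: v0); apply: unit; apply/eqP.
- exact: continuous_subspaceT.
rewrite inE in cS.
have c0 : 0 < phi c.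
  rewrite normr_gt0; apply/eqP => /bfree c0.
  by move: cS; rewrite /S /= c0 normr0 => /esym/eqP; rewrite oner_eq0.
exists (phi c)^-1; first by rewrite invr_ge0 ltW.
move=> v j; rewrite mulrC ler_pdivlMr //; have [->|vn0] := eqVneq v 0.
  by rewrite mxE normr0 mul0r.
apply: (@le_trans _ _ (`|v| * phi c)); first by rewrite ler_wpM2r ?entry // ltW.
have := cmin _ (mem_set (unit v vn0)).
by rewrite phiZ normfV normr_id mulrC ler_pdivlMr ?normr_gt0 // mulrC.
Qed.

Lemma small_basis (R : realType) (X : finDimNormedModType R) (d : R) : 0 < d ->
  exists (n : nat) (e : 'I_n -> X) (al : 'I_n -> X -> R) (M : R),
    [/\ forall x, x = \sum_j al j x *: e j,
        forall j, `|e j| <= d,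
        forall j a x y, al j (a *: x + y) = a * al j x + al j y,
        0 <= M & forall j x, `|al j x| <= M * `|x|].
Proof.
move=> d0; pose n := \dim {: X}; pose b := vbasis {: X}.
pose S := \sum_(j < n) `|b`_j| + 1.
have S0 : 0 < S by rewrite ltr_wpDl // sumr_ge0.
pose e (j : 'I_n) : X := (d / S) *: b`_j.
have dS0 : d / S != 0 by rewrite gt_eqF // divr_gt0.
have [v ev0|M M0 HM] := @coord_bound R X n e.
  apply/rowP => j; rewrite mxE.
  have /freeP bf : free b := basis_free (vbasisP _).
  have : \sum_(i < n) (v 0 i * (d / S)) *: b`_i = 0.
    by rewrite -[RHS]ev0; apply: eq_bigr => i _; rewrite scalerA.
  by move=> /bf /(_ j) /eqP; rewrite mulf_eq0 (negbTE dS0) orbF => /eqP.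
pose al (j : 'I_n) x := coord b j x / (d / S).
have alE x : x = \sum_j al j x *: e j.
  rewrite {1}(coord_vbasis (memvf x)); apply: eq_bigr => j _.
  by rewrite /al scalerA divfK.
exists n, e, al, M; split => //.
- move=> j; rewrite normrZ ger0_norm ?divr_ge0 ?(ltW d0) ?(ltW S0) //.
  rewrite mulrAC ler_pdivrMr // ler_wpM2l ?(ltW d0) // /S (bigD1 j) //= -addrA lerDl.
  by rewrite addr_ge0 // sumr_ge0.
- by move=> j a x y; rewrite /al linearP /= mulrDl mulrA.
- move=> j x; have := HM (\row_i al i x) j; rewrite mxE.
  by under eq_bigr => i _ do rewrite mxE; rewrite -alE.
Qed.

(** * Embeddings given by finitely many weighted functionals *)

Lemma ellnorm_finite (R : realType) (p : R) (y : R^nat) (N : nat) : 0 < p ->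
  (forall i, (N <= i)%N -> y i = 0) ->
  ellnorm p y = ((\sum_(i < N) `|y i| `^ p) `^ p^-1)%:E.
Proof.
move=> p0 y0; rewrite /ellnorm Lnorm_counting //.
have termE i : (`|(EFin \o y) i| `^ p = (`|y i| `^ p)%:E)%E by rewrite -poweR_EFin.
rewrite (nneseries_split 0 N); last by move=> k _; rewrite poweR_ge0.
rewrite eseries0 ?adde0; last first.
  by move=> i Ni _; rewrite termE y0 ?normr0 ?powR0 ?gt_eqF.
rewrite add0n big_mkord.
under eq_bigr => i _ do rewrite termE.
by rewrite sumEFin poweR_EFin.
Qed.

Lemma linearly_embeds_ell_finite (R : realType) (X : normedModType R)
    (T : finType) (w : T -> R) (l : T -> X -> R) (p A B D : R) :
  0 < p -> 0 < A -> 0 <= B -> 0 <= D -> A <= D * B ->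
  (forall t, 0 <= w t) ->
  (forall t a x y, l t (a *: x + y) = a * l t x + l t y) ->
  (forall x, (B * `|x|) `^ p <= \sum_t w t * `|l t x| `^ p) ->
  (forall x, \sum_t w t * `|l t x| `^ p <= (A * `|x|) `^ p) ->
  linearly_embeds_ell X p D.
Proof.
move=> p0 A0 B0 D0 AD w0 llin lower upper.
(* The weights enter the coordinates as [p]-th roots, and the sequence is padded with zeros. *)
pose F (x : X) : R^nat := fun i =>
  if insub i is Some k
  then w (enum_val (k : 'I_#|T|)) `^ p^-1 * l (enum_val k) x else 0.
have Flin : linear F.
  move=> a x y; apply/funext => i; rewrite /F !fctE /=.
  case: insubP => [k _ _|_]; last by rewrite /GRing.scale /= mulr0 addr0.
  by rewrite llin mulrDr mulrCA.
pose FL : {linear X -> R^nat} := HB.pack F (GRing.isLinear.Build _ _ _ _ F Flin).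
have FE x : ellnorm p (FL x) = ((\sum_t w t * `|l t x| `^ p) `^ p^-1)%:E.
  rewrite (@ellnorm_finite _ _ _ #|T|) //; last first.
    by move=> i Ni; rewrite /= /F insubF // ltnNge Ni.
  congr (_ `^ _)%:E; rewrite [RHS](reindex _ (onW_bij _ (@enum_val_bij T))) /=.
  apply: eq_bigr => k _; rewrite /F valK normrM powRM // norm_powR //.
  rewrite (ger0_norm (w0 _)).
  by rewrite -powRrM mulVf ?gt_eqF // powRr1.
have rootK z : 0 <= z -> (z `^ p) `^ p^-1 = z.
  by move=> z0; rewrite -powRrM divff ?gt_eqF // powRr1.
have ip0 : 0 <= p^-1 by rewrite invr_ge0 ltW.
have s0 x : 0 <= \sum_t w t * `|l t x| `^ p.
  by rewrite sumr_ge0 // => t _; rewrite mulr_ge0 ?powR_ge0.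
exists FL; split=> [x|]; first by rewrite /ell /= FE ltry.
exists A => // x; rewrite FE -EFinM !lee_fin; split.
  rewrite -[leRHS]rootK ?mulr_ge0 ?(ltW A0) //.
  by apply: ge0_ler_powR; rewrite ?nnegrE ?powR_ge0.
apply: (@le_trans _ _ (D * (B * `|x|))); first by rewrite mulrA ler_wpM2r.
rewrite ler_wpM2l // -[leLHS]rootK ?mulr_ge0 //.
by apply: ge0_ler_powR; rewrite ?nnegrE ?powR_ge0.
Qed.

(** * Rounding errors and constants *)

Lemma weighted_powR_sum_perturb (R : realType) (T : finType) (n : nat) (p : R)
    (w a : T -> R) (v : T -> 'I_n -> R) (s : 'I_n -> R) :
  0 < p -> p <= 1 -> (forall t, 0 <= w t) -> (forall j, `|s j| <= 1) ->
  \sum_t w t * `|a t + \sum_j s j * v t j| `^ p <=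
  \sum_t w t * `|a t| `^ p + \sum_j \sum_t w t * `|v t j| `^ p.
Proof.
move=> p0 p1 w0 s1; rewrite [X in _ + X]exchange_big -big_split /=.
apply: ler_sum => t _; rewrite -mulr_sumr -mulrDr ler_wpM2l //.
apply: le_trans (powR_norm_subadd _ _ p0 p1) _; rewrite lerD2l.
apply: (@le_trans _ _ (\sum_j `|s j * v t j| `^ p)).
  elim/big_ind2 : _ => [|x1 x2 y1 y2 h1 h2|//].
    by rewrite normr0 powR0 // gt_eqF.
  by apply: le_trans (powR_norm_subadd _ _ p0 p1) _; exact: lerD.
apply: ler_sum => j _; apply: ge0_ler_powR; rewrite ?nnegrE ?(ltW p0) //.
by rewrite normrM ler_piMl.
Qed.

(** The exponent is at most [1 + 2 * eps], and [1 / eps <= expR (1 / eps)] bounds the excess factor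
    by [expR 2]; so the [p]-th root keeps the order [1 / eps]. *)
Lemma powR_inv_eps_le (R : realType) (eps : R) : 0 < eps -> eps < 1 / 3 ->
  eps^-1 `^ (1 - eps)^-1 <= expR 2 / eps.
Proof.
move=> e0 e3; have q0 : 0 < 1 - eps by lra.
have i1 : 1 <= eps^-1 by rewrite invf_ge1 //; lra.
have ie : (1 - eps)^-1 <= 1 + 2 * eps by rewrite -div1r ler_pdivrMr //; nra.
apply: (@le_trans _ _ (eps^-1 `^ (1 + 2 * eps))); first exact: ler_powR.
rewrite powRD; last by rewrite (gt_eqF (lt_le_trans ltr01 i1)) implybT.
rewrite powRr1 ?invr_ge0 ?(ltW e0) // mulrC ler_wpM2r ?invr_ge0 ?(ltW e0) //.
apply: (@le_trans _ _ (expR eps^-1 `^ (2 * eps))).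
  apply: ge0_ler_powR; rewrite ?nnegrE ?expR_ge0 ?invr_ge0 ?(ltW e0) //; first lra.
  by apply: le_trans (expR_ge1Dx _); lra.
by rewrite -expRM mulrCA mulVf ?gt_eqF // mulr1.
Qed.

Lemma scale_const_le (R : realType) (c eps : R) : 1 <= c ->
  0 < eps -> eps < 1 / 3 ->
  (c / eps) `^ (1 - eps)^-1 <= c ^+ 2 * expR 2 / eps.
Proof.
move=> c1 e0 e3; have c0 : 0 <= c := le_trans ler01 c1.
rewrite powRM ?invr_ge0 ?(ltW e0) // -[leRHS]mulrA ler_pM ?powR_ge0 //; last first.
  exact: powR_inv_eps_le.
rewrite -powR_mulrn // ler_powR //.
by rewrite -div1r ler_pdivrMr; lra.
Qed.

(** * Rounding to the lattice and assembly of the embedding *)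

Theorem theorem4p1 (R : realType) (K : R) (hK : 0 < K) :
  exists2 C : R, 0 < C &
    forall (X : finDimNormedModType R) (Delta : R), 1 < Delta ->
    forall (H : completeNormedModType R), is_hilbert H ->
    forall f : X -> H,
      (forall x1 x2 : X, `|f x1 - f x2| <= K * Num.sqrt `|x1 - x2|) ->
      (forall x1 x2 : X, Delta <= `|x1 - x2| -> 1 <= `|f x1 - f x2|) ->
    forall eps : R, 0 < eps -> eps < 1 / 3 ->
      linearly_embeds_ell X (1 - eps) (C * (Delta / eps)).
Proof.
(* The bounds [2 * U] and [1 / 32] on the moments over the sphere of radius [2 * Delta] have ratio
   [64 * U], which is [s ^ p * (c / eps)]. *)
pose c := 64 * dyadic_const R.
have c1 : 1 <= c.
  by have := dyadic_const_gt1 R; rewrite /c; move: (dyadic_const R) => d; lra.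
have K2 : 0 < K ^+ 2 by rewrite exprn_gt0.
exists ((3 * K ^+ 2 + 2) * (c ^+ 2 * expR 2)).
  rewrite mulr_gt0 //; first by lra.
  by rewrite mulr_gt0 ?expR_gt0 // exprn_gt0 // (lt_le_trans ltr01).
move=> X Delta D1 H hH f fK fD eps e0 e3.
have D0 : 0 < Delta by lra.
have e1 : eps < 1 by lra.
set p := 1 - eps; have p0 : 0 < p by rewrite /p; lra.
have p1 : p <= 1 by rewrite /p; lra.
pose s := (Num.truncn (3 * K ^+ 2 * Delta + 1)).+1.
have KD0 : 0 <= 3 * K ^+ 2 * Delta + 1.
  by rewrite addr_ge0 // mulr_ge0 ?(ltW D0) // mulr_ge0 // ltW.
have sK : 3 * K ^+ 2 * Delta + 1 <= s%:R by rewrite ltW // truncnS_gt.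
(* The additive constant 2 is absorbed because [Delta > 1]; [s] carries the factor [Delta] of the
   distortion. *)
have sD : s%:R <= (3 * K ^+ 2 + 2) * Delta.
  have : (Num.truncn (3 * K ^+ 2 * Delta + 1))%:R <= 3 * K ^+ 2 * Delta + 1.
    by rewrite truncn_le.
  by rewrite /s -natr1; move: D1; rewrite mulrDl; lra.
have s0 : 0 < s%:R :> R by rewrite ltr0n.
have s1 : 1 <= s%:R :> R by rewrite ler1n.
have [n [e [al [M [alE eD allin M0 alM]]]]] := @small_basis R X Delta D0.
pose U : R := s%:R `^ p * (dyadic_const R / eps).
have U1 : 1 <= U.
  rewrite /U -[leLHS]mulr1 ler_pM ?powR_ge1 ?(ltW p0) // ler_pdivlMr //.
  by have := dyadic_const_gt1 R; lra.
have U0 : 0 < U by lra.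
have rootK (z : R) : 0 <= z -> (z `^ p^-1) `^ p = z.
  by move=> z0; rewrite -powRrM mulVf ?gt_eqF // powRr1.
(* Q^p >= 32 n U makes the error of rounding to the lattice negligible. *)
pose Q := ((Num.truncn ((32 * n%:R * U) `^ p^-1)).+1 + n)%N.
have Qpos : (0 < Q)%N by [].
have Q0 : 0 < Q%:R :> R by rewrite ltr0n.
have Qp : 32 * n%:R * U <= Q%:R `^ p.
  have h0 : 0 <= 32 * n%:R * U by rewrite mulr_ge0 ?(ltW U0) // mulr_ge0.
  rewrite -[leLHS]rootK //.
  apply: ge0_ler_powR; rewrite ?nnegrE ?powR_ge0 ?(ltW p0) //.
  apply: (@le_trans _ _ (Num.truncn ((32 * n%:R * U) `^ p^-1)).+1%:R).
    by rewrite ltW // truncnS_gt.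
  by rewrite ler_nat leq_addr.
pose g j := Q%:R^-1 *: e j.
pose B := Q%:R * (M * (2 * Delta)) + 1.
(* The first part bounds the rounded coordinates of points of norm [2 * Delta]; the summand [Q]
   admits the vectors [e j], which are [Q] times [g j]. *)
pose L := ((Num.truncn B).+1 + Q)%N.
have g_le j : `|g j| <= Delta / Q%:R.
  rewrite normrZ ger0_norm ?invr_ge0 ?ler0n // mulrC.
  by rewrite ler_wpM2r // invr_ge0 ler0n.
have gD j : `|g j| <= 3 * Delta.
  apply: le_trans (g_le j) _; rewrite ler_pdivrMr // mulrC.
  rewrite (@le_trans _ _ (1 * (3 * Delta))) //; first by lra.
  by rewrite ler_wpM2r ?ler1n // mulr_ge0 // ltW.
have [T [w [v [w0 mom]]]] :=
  @lattice_moments R X H f K Delta eps s n L g hH fK fD D0 e0 e1 sK gD.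
pose l t x := \sum_j (Q%:R * al j x) * v t j.
pose rho x := \sum_t w t * `|l t x| `^ p.
(* Each [e j] has norm at most [Delta], hence moment at most [U]; homogeneity gives [U / Q ^ p] for
   [g j], and [Q] was chosen to beat the sum over [j]. *)
have axis : \sum_j \sum_t w t * `|v t j| `^ p <= 1 / 32.
  apply: (@le_trans _ _ (\sum_(j < n) U / Q%:R `^ p)); last first.
    rewrite sumr_const card_ord -[leLHS]mulr_natl mulrA ler_pdivrMr ?powR_gt0 //.
    by lra.
  apply: ler_sum => j _; pose m i : int := Q%:Z * (i == j)%:Z.
  have mL i : (`|m i| <= L)%N.
    by rewrite /m /L; case: (i == j); rewrite ?mulr1 ?mulr0 //= leq_addl.
  have mE : \sum_i (m i)%:~R *: g i = e j.
    rewrite (bigD1 j) //= /m eqxx mulr1 big1 ?addr0 => [|i /negbTE ->].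
      by rewrite -pmulrn /g scalerA divff ?gt_eqF // scale1r.
    by rewrite mulr0 scale0r.
  have [h _] := mom m mL; rewrite mE in h.
  rewrite ler_pdivlMr ?powR_gt0 // mulrC mulr_sumr.
  apply: le_trans (h _); last by apply: le_trans (eD j) _; lra.
  rewrite le_eqVlt; apply/orP; left; apply/eqP; apply: eq_bigr => t _.
  rewrite int_dotZ int_dot_delta -pmulrn normrM powRM // mulrCA.
  by rewrite ger0_norm // ler0n.
(* On this sphere a rounding error of at most [Delta] leaves a lattice point of norm between [Delta]
   and [3 * Delta], where both moment bounds hold. *)
have shell x : `|x| = 2 * Delta -> 1 / 32 <= rho x <= 2 * U.
  move=> xD; pose m j := Num.floor (Q%:R * al j x).
  pose r j := Q%:R * al j x - (m j)%:~R.
  have r0 j : 0 <= r j by rewrite subr_ge0 floor_le.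
  have r1 j : `|r j| <= 1.
    rewrite ger0_norm // lerBlDl.
    by have /andP[_ /ltW] := floor_itv (Q%:R * al j x); rewrite intrD.
  have mL j : (`|m j| <= L)%N.
    apply: leq_trans (leq_addr _ _); rewrite ltnW // -(ltr_nat R).
    apply: le_lt_trans (truncnS_gt _); rewrite natr_absz intr_norm.
    have -> : (m j)%:~R = Q%:R * al j x - r j by rewrite /r opprB addrC subrK.
    apply: le_trans (ler_normB _ _) _; rewrite /B lerD //.
    rewrite normrM ger0_norm ?ler0n // ler_wpM2l ?ler0n //.
    by rewrite -xD.
  have lE t : l t x = int_dot m (v t) + \sum_j r j * v t j.
    rewrite -big_split; apply: eq_bigr => j _ /=.
    by rewrite -mulrDl /r addrC subrK.
  have xE : x = \sum_j (m j)%:~R *: g j + \sum_j r j *: g j.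
    rewrite {1}(alE x) -big_split; apply: eq_bigr => j _ /=.
    by rewrite -scalerDl /r addrC subrK /g scalerA mulrAC divff ?gt_eqF // mul1r.
  (* The summand [n] in [Q] yields [n * (Delta / Q) <= Delta]. *)
  have rest : `|\sum_j r j *: g j| <= Delta.
    apply: le_trans (ler_norm_sum _ _ _) _.
    apply: (@le_trans _ _ (\sum_(j < n) Delta / Q%:R)).
      apply: ler_sum => j _; rewrite normrZ -[leRHS]mul1r.
      by rewrite ler_pM.
    rewrite sumr_const card_ord -[leLHS]mulr_natl mulrA ler_pdivrMr // mulrC.
    by rewrite ler_wpM2l ?(ltW D0) // ler_nat leq_addl.
  have [up low] := mom m mL.
  move: (\sum_j (m j)%:~R *: g j) (\sum_j r j *: g j) xE rest up low => y z xE zD.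
  have y3 : `|y| <= 3 * Delta.
    have -> : y = x - z by rewrite xE addrK.
    by apply: le_trans (ler_normB _ _) _; lra.
  have y1 : Delta <= `|y|.
    by have := ler_normD y z; rewrite -xE xD; lra.
  move=> /(_ y3) up /(_ y1) low; apply/andP; split.
    (* For the lower bound the perturbation runs backwards, from [x] to its rounding, leaving
       [1 / 16 - 1 / 32]. *)
    have r1' j : `|- r j| <= 1 by rewrite normrN.
    have lE2 t : int_dot m (v t) = l t x + \sum_j (- r j) * v t j.
      under eq_bigr => j _ do rewrite mulNr.
      by rewrite sumrN lE addrK.
    have := @weighted_powR_sum_perturb R T n p w (l^~ x) v (fun j => - r j)
      p0 p1 w0 r1'.
    rewrite -(eq_bigr _ (fun t _ => congr1 (fun z => w t * `|z| `^ p) (lE2 t))).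
    move=> h; have : 1 / 16 <= rho x + 1 / 32 :=
      le_trans low (le_trans h (lerD (lexx _) axis)).
    by lra.
  have := weighted_powR_sum_perturb (fun t => int_dot m (v t)) v p0 p1 w0 r1.
  rewrite -(eq_bigr _ (fun t _ => congr1 (fun z => w t * `|z| `^ p) (lE t))).
  move=> h; have : rho x <= U + 1 / 32 := le_trans h (lerD up axis).
  by lra.
have rhoZ a x : rho (a *: x) = `|a| `^ p * rho x.
  rewrite /rho mulr_sumr; apply: eq_bigr => t _.
  have -> : l t (a *: x) = a * l t x.
    rewrite /l mulr_sumr; apply: eq_bigr => j _.
    have al0 : al j 0 = 0.
      have := allin j 1 0 0; rewrite scale1r addr0 mul1r => h.
      by apply: (addrI (al j 0)); rewrite -h addr0.
    by have := allin j a x 0; rewrite !addr0 al0 addr0 => ->; ring.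
  by rewrite normrM powRM // mulrCA.
have rho_le x : (1 / 32) * (`|x| / (2 * Delta)) `^ p <= rho x <=
    2 * U * (`|x| / (2 * Delta)) `^ p.
  have [->|x0] := eqVneq x 0.
    rewrite normr0 mul0r powR0 ?gt_eqF // !mulr0.
    have -> : rho 0 = 0 by rewrite -(scale0r 0) rhoZ normr0 powR0 ?gt_eqF // mul0r.
    by rewrite lexx.
  have nx : 0 < `|x| by rewrite normr_gt0.
  pose a := `|x| / (2 * Delta).
  have a0 : 0 < a by rewrite divr_gt0 // mulr_gt0.
  have -> : x = a *: (a^-1 *: x) by rewrite scalerA divff ?gt_eqF // scale1r.
  have /shell/andP[lo hi] : `|a^-1 *: x| = 2 * Delta.
    rewrite normrZ ger0_norm ?invr_ge0 ?(ltW a0) // /a invf_div mulrVK //.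
    by rewrite unitfE gt_eqF.
  rewrite rhoZ normrZ !(ger0_norm (ltW a0)).
  have -> : a * `|a^-1 *: x| / (2 * Delta) = a.
    rewrite normrZ ger0_norm ?invr_ge0 ?(ltW a0) // mulrA divff ?gt_eqF //.
    by rewrite mul1r.
  by rewrite mulrC ler_wpM2l ?powR_ge0 //= mulrC ler_wpM2r ?powR_ge0.
have rootE (z a : R) : 0 <= z -> 0 <= a -> (z `^ p^-1 * a) `^ p = z * a `^ p.
  by move=> z0 a0; rewrite powRM ?powR_ge0 // rootK.
have Dn0 : 0 < 2 * Delta by lra.
(* By homogeneity the bounds on the sphere extend to all of [X]; [p]-th roots turn them into norm
   bounds. *)
apply: (@linearly_embeds_ell_finite R X T w l p ((2 * U) `^ p^-1 / (2 * Delta))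
  ((1 / 32) `^ p^-1 / (2 * Delta))) => //.
- by rewrite divr_gt0 // powR_gt0 // mulr_gt0.
- by rewrite divr_ge0 ?powR_ge0 // ltW.
- rewrite mulr_ge0 ?divr_ge0 ?(ltW D0) ?(ltW e0) // mulr_ge0 //; first by lra.
  by rewrite mulr_ge0 ?expR_ge0 ?sqr_ge0.
- rewrite mulrA ler_wpM2r ?invr_ge0 ?(ltW Dn0) //.
  have -> : 2 * U = 64 * U * (1 / 32) by field.
  have U64 : 0 <= 64 * U by lra.
  have i32 : 0 <= 1 / 32 :> R by lra.
  rewrite (powRM _ U64 i32) ler_wpM2r ?powR_ge0 //.
  have -> : 64 * U = s%:R `^ p * (c / eps) by rewrite /U /c; ring.
  have ce0 : 0 <= c / eps by rewrite divr_ge0 ?(ltW e0) // (le_trans ler01).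
  rewrite powRM ?powR_ge0 // -powRrM divff ?gt_eqF // powRr1 ?ler0n //.
  apply: (@le_trans _ _ (((3 * K ^+ 2 + 2) * Delta) * (c ^+ 2 * expR 2 / eps))).
    by rewrite ler_pM ?powR_ge0 ?ler0n // scale_const_le.
  by rewrite le_eqVlt; apply/orP; left; apply/eqP; ring.
- move=> t a x y; rewrite /l mulr_sumr -big_split; apply: eq_bigr => j _ /=.
  by rewrite allin; ring.
- move=> x; rewrite -mulrA [_^-1 * _]mulrC rootE //; last first.
    by rewrite divr_ge0 // ltW.
  by have /andP[] := rho_le x.
- move=> x; rewrite -mulrA [_^-1 * _]mulrC rootE //; first last.
  + by rewrite divr_ge0 // ltW.
  + by rewrite mulr_ge0 // ltW.
  by have /andP[] := rho_le x.
Qed.
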